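(* Let $1\le p<\infty$ and $0\le\lambda<1$, and let $w$ be a weight on $\mathbb R$. If the Hilbert transform $H$ is bounded from $\mathcal L^{p,\lambda}(w)$ to $W\mathcal L^{p,\lambda}(w)$, then $w\in A_{p+\lambda}$.
   Context: The setting is $\mathbb R$ (dimension one). A weight is a locally integrable function $w$ on $\mathbb R$ with $w>0$ a.e.; $w(A)=\int_A w$. $Hf(x)=\frac1\pi\,\mathrm{p.v.}\int_{\mathbb R}\frac{f(y)}{x-y}\,dy$. Boundedness means that $H$ is defined on $\mathcal L^{p,\lambda}(w)$ and there is $C$ with $\|Hf\|_{W\mathcal L^{p,\lambda}(w)}\le C\|f\|_{\mathcal L^{p,\lambda}(w)}$ for all $f\in\mathcal L^{p,\lambda}(w)$. Morrey norm (with $B(x,r)=(x-r,x+r)$): $\|f\|_{\mathcal L^{p,\lambda}(w)}=\sup_{x\in\mathbb R,\,r>0}\big(\frac1{r^\lambda}\int_{B(x,r)}|f|^p w\big)^{1/p}$, and $\mathcal L^{p,\lambda}(w)$ is the set of measurable $f$ with finite norm. Weak Morrey norm: $\|f\|_{W\mathcal L^{p,\lambda}(w)}=\sup_{x\in\mathbb R,\,r>0,\,t>0}\big(\frac{t^p\,w(\{y\in B(x,r):|f(y)|>t\})}{r^\lambda}\big)^{1/p}$. For $1<q<\infty$, $w\in A_q$ iff $\sup_I\frac{w(I)}{|I|}\big(\frac{w^{1-q'}(I)}{|I|}\big)^{q-1}<\infty$ over all bounded intervals $I$, $1/q+1/q'=1$; $w\in A_1$ iff there is $c$ with $\frac{w(I)}{|I|}\le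 c\,w(x)$ for every bounded interval $I$ and a.e. $x\in I$. *)

(* Defs.v *)
From HB Require Import structures.
From mathcomp Require Import all_boot all_order all_algebra.
From mathcomp Require Import all_classical all_reals all_analysis.

Set Implicit Arguments.
Unset Strict Implicit.
Unset Printing Implicit Defensive.

Import Order.TTheory GRing.Theory Num.Theory.
Import numFieldNormedType.Exports.

Local Open Scope classical_set_scope.
Local Open Scope ring_scope.

(* Measurability is Borel measurability throughout, as in [locally_integrable];
   everything below depends on [w] and [f] only up to equality a.e., so this
   is the same as working with Lebesgue measurable functions. *)

Definition weight (R : realType) (w : R -> R) : Prop :=
  locally_integrable setT w /\
  {ae @lebesgue_measure R, forall x, 0 < w x}.

Definition wmass (R : realType) (w : R -> R) (A : set R) : \bar R :=
  (\int[@lebesgue_measure R]_(x in A) (w x)%:E)%E.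

Definition B (R : realType) (x r : R) : set R := `]x - r, x + r[%classic.

Definition morrey_norm (R : realType) (p lam : R) (w f : R -> R) : \bar R :=
  ereal_sup [set s : \bar R | exists x r : R, 0 < r /\
    s = (((r `^ lam)^-1%:E *
         \int[@lebesgue_measure R]_(y in B x r) (`|f y| `^ p * w y)%:E)
           `^ p^-1)%E].

Definition morrey (R : realType) (p lam : R) (w : R -> R) : set (R -> R) :=
  [set f | measurable_fun setT f /\ (morrey_norm p lam w f < +oo)%E].

Definition weak_morrey_norm (R : realType) (p lam : R) (w g : R -> R) : \bar R :=
  ereal_sup [set s : \bar R | exists x r t : R, [/\ 0 < r, 0 < t &
    s = (((t `^ p / r `^ lam)%:E *
         wmass w [set y | B x r y /\ (t < `|g y|)%R]) `^ p^-1)%E]].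

Definition trunc_dom (R : realType) (x eps : R) : set R :=
  [set y | eps < `|x - y|].

Definition trunc_integral (R : realType) (f : R -> R) (x eps : R) : R :=
  \int[@lebesgue_measure R]_(y in trunc_dom x eps) (f y / (x - y)).

(* The principal value exists at [x]: every truncated integral converges
   absolutely (otherwise [trunc_integral] is a junk value) and the truncated
   integrals have a finite limit. *)
Definition hilbert_defined_at (R : realType) (f : R -> R) (x : R) : Prop :=
  (forall eps : R, 0 < eps ->
     (@lebesgue_measure R).-integrable (trunc_dom x eps)
       (fun y => (f y / (x - y))%:E)) /\
  cvg (trunc_integral f x eps @[eps --> 0^'+]).

(* Meaningful only where [hilbert_defined_at f x] holds. *)
Definition hilbert (R : realType) (f : R -> R) (x : R) : R :=
  pi^-1 * lim (trunc_integral f x eps @[eps --> 0^'+]).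

Definition hilbert_bounded (R : realType) (p lam : R) (w : R -> R) : Prop :=
  (forall f, morrey p lam w f ->
     {ae @lebesgue_measure R, forall x, hilbert_defined_at f x}) /\
  (exists C : R, forall f, morrey p lam w f ->
     (weak_morrey_norm p lam w (hilbert f) <=
      C%:E * morrey_norm p lam w f)%E).

Definition conj_exponent (R : realType) (q : R) : R := q / (q - 1).

Definition A1_class (R : realType) (w : R -> R) : Prop :=
  exists c : R, forall a b : R, a < b ->
    {ae @lebesgue_measure R, forall x, `]a, b[%classic x ->
       ((b - a)^-1%:E * wmass w `]a, b[%classic <= (c * w x)%:E)%E}.

Definition Aq_class (R : realType) (q : R) (w : R -> R) : Prop :=
  (ereal_sup [set s : \bar R | exists a b : R, (a < b)%R /\
     s = ((b - a)^-1%:E * wmass w `]a, b[%classic) *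
         ((b - a)^-1%:E *
            wmass (fun x => (w x `^ (1 - conj_exponent q))%R) `]a, b[%classic)
           `^ (q - 1)%R] < +oo)%E.

Definition muckenhoupt (R : realType) (q : R) (w : R -> R) : Prop :=
  (q = 1 /\ A1_class w) \/ (1 < q /\ Aq_class q w).

(* Main.v *)
Require Import Defs.
From mathcomp Require Import all_boot all_order all_algebra.
From mathcomp Require Import all_classical all_reals all_analysis.
From mathcomp Require Import measurable_realfun.
From mathcomp Require Import ring lra.
Import Order.TTheory GRing.Theory Num.Theory.
Import numFieldNormedType.Exports.
Local Open Scope classical_set_scope.
Local Open Scope ring_scope.
Set Implicit Arguments.
Unset Strict Implicit.
Unset Printing Implicit Defensive.

(** Put q = p + lam and, for q > 1, sigma = w^(-1/(q-1)) = w^(1-q').  The proof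
    tests the boundedness of the Hilbert transform on functions supported in
    one interval and looks at the neighbouring one.

    If f >= 0 lives in an interval I of length l and J is adjacent to I and of
    the same length, then for y in J the kernel 1/(y - x) has constant sign and
    modulus at least 1/(2l) for all x in I; hence |Hf| >= (2 pi l)^-1 int_I f
    on J ([hilbert_ge]).  Boundedness into the weak space turns this into a
    testing inequality ([hilbert_testing]): if int_B f^p w <= M r^lam for every
    ball B of radius r, then
      w(J) (int_I f)^p <= K l^q M.

    For q > 1, test with f = sigma on I.  The exponent of sigma is chosen so
    that sigma^p w = sigma^(1-lam), and Hoelder with exponents 1/(1-lam) and
    1/lam gives int_(B meet I) sigma^(1-lam) <= sigma(I)^(1-lam) (2r)^lam,
    which is a bound of Morrey type.  Dividing by sigma(I)^(1-lam) leaves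
      w(J) sigma(I)^(q-1) <= 2^lam K l^q          ([dual_mass_le]).
    As sigma(I) may be infinite a priori, the argument is run on the sets where
    w >= e, followed by monotone convergence.

    This is the A_q condition with two different intervals.  They are compared
    by Hoelder again: l^q <= w(I) sigma(I)^(q-1), so the last display forces
    w(J) <= 2^lam K w(I) ([mass_adjacent_le]), and, the roles of I and J being
    symmetric, w(I) and w(J) are comparable.

    For q = 1, that is p = 1 and lam = 0, test with indicators of measurable
    E contained in I: w(J) |E| <= K l w(E).  With E = I and I, J exchanged this
    gives again w(I) <= K w(J), so w(I)/l <= K^2 w(E)/|E| for all E in I with
    |E| > 0; the set where K^2 w < w(I)/l is therefore null. *)

(** * Lebesgue measure and integrals *)

Section Preliminaries.
Context {R : realType}.
Notation mu := (@lebesgue_measure R).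

Lemma lebesgue_aeS (P Q : R -> Prop) : (forall x, P x -> Q x) ->
  {ae mu, forall x, P x} -> {ae mu, forall x, Q x}.
Proof.
move=> PQ [N [mN N0 PN]]; exists N; split => //.
by apply: subset_trans PN => x; apply: contra_not; exact: PQ.
Qed.

Lemma lebesgue_aeS2 (P Q S : R -> Prop) : (forall x, P x -> Q x -> S x) ->
  {ae mu, forall x, P x} -> {ae mu, forall x, Q x} -> {ae mu, forall x, S x}.
Proof.
move=> PQS [N [mN N0 PN]] [N' [mN' N'0 QN']].
exists (N `|` N'); split; first exact: measurableU.
  by rewrite measureU0.
move=> x /= nS; have [Px|nP] := pselect (P x); last by left; exact: PN.
by right; apply: QN' => /= Qx; apply: nS; exact: PQS.
Qed.

Lemma lebesgue_measure_adjacent (a l : R) : 0 < l -> mu `]a, (a + l)%R[ = l%:E.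
Proof.
move=> l0; rewrite lebesgue_measure_itv/= lte_fin ltrDl l0.
by rewrite -EFinD addrC addKr.
Qed.

Lemma mu_subset_fin (A : set R) (a b : R) : a < b -> measurable A ->
  A `<=` `]a, b[ -> exists2 m : R, 0 <= m & mu A = m%:E.
Proof.
move=> ab mA AI.
have muA : (mu A <= (b - a)%:E)%E.
  have <- : mu `]a, b[ = (b - a)%:E.
    by rewrite lebesgue_measure_itv/= lte_fin ab.
  by apply: le_measure; rewrite ?inE.
have fA : mu A \is a fin_num by rewrite ge0_fin_numE// (le_lt_trans muA) ?ltry.
exists (fine (mu A)); last by rewrite fineK.
by rewrite fine_ge0.
Qed.

Lemma measurable_superlevel (v : R -> R) (e : R) :
  measurable_fun setT v -> measurable [set x | (e <= v x)%R].
Proof.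
move=> mv.
have mle : measurable_fun setT (fun x => e <= v x).
  exact: measurable_fun_ler.
have := mle measurableT [set true].
by rewrite setTI; apply.
Qed.

Lemma measurable_fun_powR (A : set R) (f : R -> R) (r : R) :
  measurable_fun A f -> measurable_fun A (fun x => f x `^ r).
Proof.
by move=> mf; apply: (measurableT_comp (f := @powR R ^~ r)).
Qed.

Lemma integral_gt0 (A : set R) (u : R -> R) :
  measurable A -> measurable_fun A u -> (forall x, A x -> 0 < u x) ->
  (0 < mu A)%E -> (0 < \int[mu]_(x in A) (u x)%:E)%E.
Proof.
move=> mA mf f0 muA.
have I0 : (0 <= \int[mu]_(x in A) (u x)%:E)%E.
  by apply: integral_ge0 => x Ax; rewrite lee_fin ltW// f0.
rewrite lt_def I0 andbT; apply/eqP => If0.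
have mfE : measurable_fun A (fun x => (u x)%:E) by exact/measurable_EFinP.
have : (\int[mu]_(x in A) `|(u x)%:E| = 0)%E.
  rewrite -If0; apply: eq_integral => x /set_mem Ax.
  by rewrite gee0_abs// lee_fin ltW// f0.
move=> /(ae_eq_integral_abs mu mA mfE)[N [mN N0 AN]].
suff : (mu A <= mu N)%E by rewrite N0 leNgt muA.
apply: le_measure; rewrite ?inE// => x Ax; apply: AN => /= /(_ Ax)[ux0].
by have := f0 _ Ax; rewrite ux0 ltxx.
Qed.

Lemma weighted_amgm (a b th : R) : 0 <= a -> 0 <= b -> 0 < th -> th <= 1 ->
  a `^ th * b `^ (1 - th) <= th * a + (1 - th) * b.
Proof.
rewrite le_eqVlt => /predU1P[<- b0 th0 th1|a0].
  by rewrite powR0 ?gt_eqF// mul0r mulr0 add0r mulr_ge0// subr_ge0.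
rewrite le_eqVlt => /predU1P[<- th0|b0 th0].
  rewrite mulr0 addr0 le_eqVlt => /predU1P[->|th1].
    by rewrite subrr powRr0 mulr1 mul1r powRr1// ltW.
  by rewrite (powR0 (x := 1 - th)) ?gt_eqF ?subr_gt0// mulr0 mulr_ge0// ltW.
move=> th1.
have := @concave_ln R (Itv01 (ltW th0) th1) _ _ a0 b0.
rewrite !convRE/= -[_ <= ln _]ler_expR expRD.
rewrite lnK ?posrE; last first.
  have : 0 <= (1 - th) * b by rewrite mulr_ge0 ?subr_ge0// ltW.
  by move=> ?; rewrite ltr_wpDr// mulr_gt0.
by rewrite /powR !gt_eqF.
Qed.

(** Hoelder's inequality for the exponents 1/th and 1/(1-th), obtained by
    integrating the arithmetic-geometric mean inequality for f/a and g/b.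
    Upper bounds a, b instead of the integrals themselves avoid all discussion
    of null or infinite integrals, and th = 1 is allowed: this is the case
    lam = 0 of the application. *)
Lemma hoelder_bound (A : set R) (f g : R -> R) (th a b : R) :
  measurable A -> measurable_fun A f -> measurable_fun A g ->
  (forall x, A x -> 0 <= f x) -> (forall x, A x -> 0 <= g x) ->
  0 < th -> th <= 1 -> 0 < a -> 0 < b ->
  (\int[mu]_(x in A) (f x)%:E <= a%:E)%E ->
  (\int[mu]_(x in A) (g x)%:E <= b%:E)%E ->
  (\int[mu]_(x in A) (f x `^ th * g x `^ (1 - th))%:E <=
   (a `^ th * b `^ (1 - th))%:E)%E.
Proof.
move=> mA mf mg f0 g0 th0 th1 a0 b0 fa gb.
set k := a `^ th * b `^ (1 - th).
have k0 : 0 < k by rewrite mulr_gt0// powR_gt0.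
have th1' : 0 <= 1 - th by rewrite subr_ge0.
set u := k * th / a; set v := k * (1 - th) / b.
have u0 : 0 <= u by apply/divr_ge0/ltW => //; apply: mulr_ge0; exact: ltW.
have v0 : 0 <= v by apply/divr_ge0/ltW => //; apply: mulr_ge0 => //; exact: ltW.
have mfE : measurable_fun A (fun x => (f x)%:E) by exact/measurable_EFinP.
have mgE : measurable_fun A (fun x => (g x)%:E) by exact/measurable_EFinP.
apply: (@le_trans _ _
  (\int[mu]_(x in A) (u%:E * (f x)%:E + v%:E * (g x)%:E))%E).
  apply: ge0_le_integral => //.
  - by move=> x Ax; rewrite lee_fin mulr_ge0// powR_ge0.
  - apply/measurable_EFinP; apply: measurable_funM.
      exact: measurable_fun_powR.
    exact: measurable_fun_powR.
  - by apply: emeasurable_funD; apply: measurable_funeM.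
  - move=> x Ax; rewrite -!EFinM -EFinD lee_fin.
    have fx := f0 _ Ax; have gx := g0 _ Ax.
    have := weighted_amgm (divr_ge0 fx (ltW a0)) (divr_ge0 gx (ltW b0)) th0 th1.
    move/(ler_wpM2l (ltW k0)).
    have -> : k * (th * (f x / a) + (1 - th) * (g x / b)) = u * f x + v * g x.
      by rewrite /u /v; ring.
    apply: le_trans; rewrite le_eqVlt; apply/orP; left; apply/eqP.
    rewrite {1}(_ : f x = a * (f x / a)); last by rewrite mulrC divfK// gt_eqF.
    rewrite {1}(_ : g x = b * (g x / b)); last by rewrite mulrC divfK// gt_eqF.
    rewrite (powRM _ (ltW a0)) ?divr_ge0 ?(ltW a0)//.
    rewrite (powRM _ (ltW b0)) ?divr_ge0 ?(ltW b0)//.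
    by rewrite /k; ring.
rewrite ge0_integralD//; last 4 first.
  - by move=> x Ax; rewrite -EFinM lee_fin mulr_ge0// f0.
  - exact: measurable_funeM.
  - by move=> x Ax; rewrite -EFinM lee_fin mulr_ge0// g0.
  - exact: measurable_funeM.
rewrite !ge0_integralZl_EFin//.
apply: le_trans (leeD (lee_wpmul2l _ fa) (lee_wpmul2l _ gb)) _.
- by rewrite lee_fin.
- by rewrite lee_fin.
rewrite -!EFinM -EFinD lee_fin /u /v !divfK ?gt_eqF//.
by rewrite -mulrDr addrC subrK mulr1.
Qed.

End Preliminaries.

(** * Lower bound for the Hilbert transform away from the support *)

Section Hilbert.
Context {R : realType}.
Notation mu := (@lebesgue_measure R).

Lemma trunc_integral_far (S : set R) (f : R -> R) (y d eps : R) :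
  (forall x, ~ S x -> f x = 0) -> (forall x, S x -> d <= `|y - x|) ->
  eps < d -> trunc_integral f y eps = \int[mu]_(x in S) (f x / (y - x)).
Proof.
move=> f0 Sd epsd; rewrite /trunc_integral Rintegral_mkcond.
rewrite [RHS]Rintegral_mkcond; congr Rintegral; apply/funext => x.
rewrite !patchE; have [xS|xS] := boolP (x \in S).
  rewrite mem_set// /trunc_dom/=; apply: lt_le_trans epsd _.
  by apply: Sd; exact/set_mem.
rewrite f0; last by move=> /mem_set; exact/negP.
by rewrite mul0r if_same.
Qed.

(** Truncation has no effect once its radius is smaller than the distance d to
    the support, so that the principal value is an ordinary integral. *)
Lemma hilbert_far (S : set R) (f : R -> R) (y d : R) : 0 < d ->
  (forall x, ~ S x -> f x = 0) -> (forall x, S x -> d <= `|y - x|) ->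
  hilbert f y = pi^-1 * \int[mu]_(x in S) (f x / (y - x)).
Proof.
move=> d0 f0 Sd; rewrite /hilbert; congr (_ * _).
apply: lim_near_cst => //.
near=> eps; apply: trunc_integral_far f0 Sd _.
by near: eps; exact: nbhs_right_lt.
Unshelve. all: by end_near. Qed.

(** The sign e = 1 or -1 records on which side of S the point y lies; as
    0 < d <= e (y - x) <= D for x in S, the kernel has constant sign and modulus
    at least 1/D, so nothing cancels. *)
Lemma hilbert_ge (S : set R) (f : R -> R) (e d D y : R) :
  measurable S -> mu.-integrable S (fun x => (f x)%:E) ->
  (forall x, 0 <= f x) -> (forall x, ~ S x -> f x = 0) ->
  e * e = 1 -> 0 < d -> (forall x, S x -> d <= e * (y - x) <= D) ->
  pi^-1 * (\int[mu]_(x in S) f x / D) <= `|hilbert f y|.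
Proof.
move=> mS intf f0 fS ee d0 Sd.
have e1 : `|e| = 1.
  by apply/eqP; rewrite -(@eqrXn2 _ 2)// -normrX expr2 ee expr1n normr1.
have mf : measurable_fun S f by case/integrableP : intf => /measurable_EFinP.
have Sn x : S x -> `|y - x| = e * (y - x).
  move=> /Sd /andP[dx _]; rewrite -[LHS]mul1r -e1 -normrM ger0_norm//.
  exact: le_trans (ltW d0) dx.
have ek x : S x -> (y - x)^-1 = e * (e * (y - x))^-1.
  move=> /Sd /andP[dx _].
  have := lt_le_trans d0 dx => {dx} dx.
  have yx : y - x != 0 by apply: contraTneq dx => ->; rewrite mulr0 ltxx.
  have en : e != 0 by rewrite -normr_eq0 e1 oner_eq0.
  by rewrite invfM mulrA divff// mul1r.
have intk : mu.-integrable S (fun x => (f x / (y - x))%:E).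
  apply: (@le_integrable _ _ _ mu S mS _ (fun x => (d^-1 * f x)%:E)).
  - apply/measurable_EFinP.
    (* On S the reciprocal is e times a real power of a positive function. *)
    apply: (@eq_measurable_fun _ _ _ _ S
      (fun x => f x * (e * (e * (y - x)) `^ (-1)))).
      move=> x /set_mem Sx; rewrite powR_inv1 ?ek//.
      by rewrite -Sn.
    apply: measurable_funM => //; apply: measurable_funM => //.
    apply: measurable_fun_powR; apply: measurable_funM => //.
    exact: measurable_funB.
  - move=> x Sx; rewrite lee_fin !normrM mulrC ler_wpM2r//.
    rewrite normfV Sn// normfV (gtr0_norm d0) lef_pV2 ?posrE//.
    + by case/andP: (Sd _ Sx).
    + by case/andP: (Sd _ Sx) => dx _; apply: lt_le_trans dx.
  - under eq_fun do rewrite EFinM.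
    exact: integrableZl.
rewrite (@hilbert_far S f y d)//; last first.
  by move=> x Sx; rewrite Sn//; case/andP: (Sd _ Sx).
rewrite normrM ger0_norm ?invr_ge0 ?pi_ge0// ler_wpM2l ?invr_ge0 ?pi_ge0//.
rewrite -[leRHS]mul1r -e1 -normrM (le_trans _ (ler_norm _))//.
rewrite -RintegralZr// -RintegralZl//; apply: le_Rintegral => //.
- exact: (@integrableZr _ _ _ mu S mS D^-1 _ intf).
- exact: (@integrableZl _ _ _ mu S mS e _ intk).
- move=> x Sx; rewrite ek// mulrCA [e * (e * _)]mulrA ee mul1r ler_wpM2l//.
  case/andP: (Sd _ Sx) => dx xD.
  rewrite lef_pV2 ?posrE// ?(lt_le_trans d0)//.
  exact: le_trans xD.
Qed.

End Hilbert.

(** * The testing inequality *)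

Section Testing.
Context {R : realType}.
Notation mu := (@lebesgue_measure R).

(** A weight may take nonpositive values on a null set, where its real powers
    are meaningless.  Replacing it by this positive representative changes no
    integral against it. *)
Definition positive_version (w : R -> R) (x : R) : R :=
  if 0 < w x then w x else 1.

Lemma positive_version_gt0 w x : 0 < positive_version w x.
Proof. by rewrite /positive_version; case: ifPn. Qed.

Lemma measurable_positive_version w : measurable_fun setT w ->
  measurable_fun setT (positive_version w).
Proof.
move=> mw; apply: measurable_fun_ifT => //.
exact: measurable_fun_ltr.
Qed.

Lemma positive_version_ae w : {ae mu, forall x, 0 < w x} ->
  {ae mu, forall x, w x = positive_version w x}.
Proof.
by apply: lebesgue_aeS => x wx; rewrite /positive_version wx.
Qed.

Section Versions.
Variables (w v : R -> R).
Hypotheses (mw : measurable_fun setT w) (mv : measurable_fun setT v).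
Hypothesis wv : {ae mu, forall x, w x = v x}.

Lemma eq_integral_version (A : set R) (g : R -> R) :
  measurable A -> measurable_fun A g ->
  (\int[mu]_(x in A) (g x * w x)%:E = \int[mu]_(x in A) (g x * v x)%:E)%E.
Proof.
move=> mA mg; apply: ae_eq_integral => //.
- apply/measurable_EFinP; apply: measurable_funM => //.
  exact: measurable_funS mw.
- apply/measurable_EFinP; apply: measurable_funM => //.
  exact: measurable_funS mv.
- by apply: lebesgue_aeS wv => x -> _.
Qed.

Lemma wmass_version (A : set R) : measurable A -> wmass w A = wmass v A.
Proof.
move=> mA; have := @eq_integral_version A (cst 1) mA (measurable_cst _).
by under eq_integral do rewrite mul1r; under [RHS]eq_integral do rewrite mul1r.
Qed.

Lemma morrey_norm_version (p lam : R) f : measurable_fun setT f ->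
  morrey_norm p lam w f = morrey_norm p lam v f.
Proof.
move=> mf; rewrite /morrey_norm; congr ereal_sup; apply/seteqP.
split => _ [x [r [r0 ->]]]; exists x, r; split => //; congr ((_ * _) `^ _)%E.
  apply: eq_integral_version; first exact: measurable_itv.
  apply: measurable_fun_powR; apply: measurableT_comp => //.
  exact: measurable_funS mf.
apply/esym/eq_integral_version; first exact: measurable_itv.
apply: measurable_fun_powR; apply: measurableT_comp => //.
exact: measurable_funS mf.
Qed.

End Versions.

Lemma morrey_norm_le (p lam M : R) (v f : R -> R) :
  0 < p -> (forall x, 0 <= v x) -> (forall x, 0 <= f x) -> 0 <= M ->
  (forall x r : R, 0 < r -> (\int[mu]_(y in B x r) (f y `^ p * v y)%:E <=
                         (M * r `^ lam)%:E)%E) ->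
  (morrey_norm p lam v f <= (M `^ p^-1)%:E)%E.
Proof.
move=> p0 v0 f0 M0 fM; apply/ub_ereal_sup => _ [x [r [r0 ->]]].
under eq_integral do rewrite ger0_norm//.
have I0 : (0 <= \int[mu]_(y in B x r) (f y `^ p * v y)%:E)%E.
  by apply: integral_ge0 => y _; rewrite lee_fin mulr_ge0// powR_ge0.
have rl : 0 < r `^ lam by exact: powR_gt0.
have le :
    ((r `^ lam)^-1%:E * \int[mu]_(y in B x r) (f y `^ p * v y)%:E <= M%:E)%E.
  apply: le_trans (lee_wpmul2l _ (fM x r r0)) _.
    by rewrite lee_fin invr_ge0 ltW.
  by rewrite -EFinM lee_fin mulrC mulfK// gt_eqF.
rewrite -poweR_EFin; apply: gt0_ler_poweR => //.
- by rewrite invr_ge0 ltW.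
- by rewrite in_itv/= leey andbT mule_ge0// lee_fin invr_ge0 ltW.
- by rewrite in_itv/= leey andbT lee_fin.
Qed.

Lemma morrey_norm_ge0 (p lam : R) (v f : R -> R) :
  (0 <= morrey_norm p lam v f)%E.
Proof.
apply: (@le_trans _ _ ((((1 `^ lam)^-1%:E *
  \int[mu]_(y in B 0 1) (`|f y| `^ p * v y)%:E) `^ p^-1)%E)).
  exact: poweR_ge0.
by apply: ereal_sup_ubound; exists 0, 1.
Qed.

(** What boundedness of the Hilbert transform says about two adjacent intervals
    (a, a + l) and (c, c + l): V is the mass of the second one, and M is a
    p-th power of a Morrey bound for the function f supported in the first. *)
Definition testing_condition (p lam : R) (v : R -> R) (K : R) : Prop :=
  forall (a c l M V : R) (f : R -> R),
    0 < l -> c = a + l \/ c = a - l ->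
    measurable_fun setT f -> (forall x, 0 <= f x) ->
    (forall x, ~ `]a, a + l[%classic x -> f x = 0) ->
    mu.-integrable `]a, a + l[ (fun x => (f x)%:E) ->
    0 <= M ->
    (forall x r : R, 0 < r -> (\int[mu]_(y in B x r) (f y `^ p * v y)%:E <=
                         (M * r `^ lam)%:E)%E) ->
    wmass v `]c, c + l[ = V%:E ->
    V * (\int[mu]_(x in `]a, (a + l)[) f x) `^ p <= K * l `^ (p + lam) * M.

(** The function f belongs to the Morrey space, and its transform exceeds
    t = s/(4 pi l), half of the bound of [hilbert_ge], on all of (c, c + l),
    where s is the integral of f.  Hence the weak norm of Hf contains the term
    of the ball (c, c + l) at height t.  Two weights occur because boundedness
    is known for w, while positivity everywhere is available for v only. *)
Lemma hilbert_testing (p lam : R) (w v : R -> R) :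
  1 <= p -> 0 <= lam -> hilbert_bounded p lam w ->
  measurable_fun setT w -> measurable_fun setT v ->
  {ae mu, forall x, w x = v x} -> (forall x, 0 < v x) ->
  exists2 K : R, 0 < K & testing_condition p lam v K.
Proof.
move=> p1 lam0 [_ [C0 HC]] mw mv wv v0.
have p0 : 0 < p by exact: lt_le_trans p1.
(* The constant given by boundedness may fail to be positive. *)
pose C : R := `|C0| + 1.
have C_gt0 : 0 < C by rewrite ltr_wpDl.
have C0C : C0 <= C by rewrite (le_trans (ler_norm _))// lerDl.
exists ((C * (4 * pi)) `^ p).
  by rewrite powR_gt0// mulr_gt0// mulr_gt0// pi_gt0.
move=> a c l M V f l0 adj mf f0 fS intf M0 fM vJ.
set s := \int[mu]_(x in _) f x.
have V0 : 0 <= V.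
  by rewrite -lee_fin -vJ; apply: integral_ge0 => x _; rewrite lee_fin ltW.
have s0 : 0 <= s by exact: Rintegral_ge0.
have RHS0 : 0 <= (C * (4 * pi)) `^ p * l `^ (p + lam) * M.
  by rewrite !mulr_ge0// ?powR_ge0.
have [s_eq0|s_neq0] := eqVneq s 0.
  by rewrite s_eq0 powR0 ?gt_eqF// mulr0.
have {s_neq0}s_gt0 : 0 < s by rewrite lt_def s_neq0.
have pi0 := pi_gt0 R.
pose t : R := pi^-1 * (s / (4 * l)).
have t0 : 0 < t by rewrite mulr_gt0 ?invr_gt0// divr_gt0// mulr_gt0.
have Hlow y : `]c, c + l[%classic y -> t < `|hilbert f y|.
  rewrite /= in_itv/= => /andP[cy ycl].
  apply: (@lt_le_trans _ _ (pi^-1 * (s / (2 * l)))).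
    rewrite /t ltr_pM2l ?invr_gt0// ltr_pM2l// ltf_pV2 ?posrE ?mulr_gt0//.
    by rewrite ltr_pM2r// ltr_nat.
  case: adj => cE; subst c.
    apply: (@hilbert_ge R _ f 1 (y - (a + l))) => //; first exact: mulr1.
      by rewrite subr_gt0.
    by move=> x; rewrite /= in_itv/= => /andP[ax xl]; apply/andP; split; lra.
  apply: (@hilbert_ge R _ f (-1) (a - y)) => //; first by rewrite mulrNN mulr1.
    by rewrite subr_gt0; lra.
  by move=> x; rewrite /= in_itv/= => /andP[ax xl]; apply/andP; split; lra.
have norm_le : (morrey_norm p lam w f <= (M `^ p^-1)%:E)%E.
  rewrite (morrey_norm_version mw mv wv)//.
  by apply: morrey_norm_le => // x; exact: ltW.
have fmor : morrey p lam w f.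
  by split => //; apply: le_lt_trans norm_le _; exact: ltry.
pose r : R := l / 2.
have r0 : 0 < r by rewrite divr_gt0.
have BJ : [set y | B (c + r) r y /\ t < `|hilbert f y|] = `]c, c + l[%classic.
  have BE : B (c + r) r = `]c, c + l[%classic.
    by rewrite /B addrK -addrA -[r + r]mulr2n -mulr_natr /r divfK.
  by rewrite BE; apply/seteqP; split => [y []//|y Jy]; split => //; exact: Hlow.
have : (((t `^ p / r `^ lam * V) `^ p^-1)%:E <= (C * M `^ p^-1)%:E)%E.
  apply: (@le_trans _ _ (weak_morrey_norm p lam w (hilbert f))).
    apply: ereal_sup_ubound; exists (c + r), r, t; split => //.
    by rewrite BJ (wmass_version mw mv wv) ?vJ//; exact: measurable_itv.
  apply: le_trans (HC _ fmor) _.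
  apply: (@le_trans _ _ (C%:E * morrey_norm p lam w f)%E).
    by apply: lee_wpmul2r; [exact: morrey_norm_ge0|rewrite lee_fin].
  by rewrite EFinM; apply: lee_wpmul2l => //; rewrite lee_fin ltW.
rewrite lee_fin => key.
have X0 : 0 <= t `^ p / r `^ lam * V.
  by rewrite mulr_ge0// divr_ge0// powR_ge0.
have {key} : t `^ p / r `^ lam * V <= C `^ p * M.
  have CM0 : 0 <= C * M `^ p^-1 by rewrite mulr_ge0 ?powR_ge0// ltW.
  have : ((t `^ p / r `^ lam * V) `^ p^-1) `^ p <= (C * M `^ p^-1) `^ p.
    by apply: ge0_ler_powR key; rewrite ?nnegrE ?powR_ge0// ltW.
  rewrite (powRM _ (ltW C_gt0)) ?powR_ge0//.
  by rewrite -!powRrM mulVf ?gt_eqF// !powRr1.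
move=> key.
have rl : 0 < r `^ lam by exact: powR_gt0.
have rll : r `^ lam <= l `^ lam.
  by apply: ge0_ler_powR => //; rewrite ?nnegrE ?ltW// /r; lra.
have sE : s = t * (4 * pi * l).
  rewrite /t; move: (pi : R) pi0 => P P0; field.
  by rewrite !gt_eqF.
have fl : 0 < 4 * pi * l by rewrite !mulr_gt0.
rewrite sE (powRM _ (ltW t0) (ltW fl)).
have {key} : t `^ p * V <= C `^ p * M * r `^ lam.
  by rewrite -ler_pdivrMr// mulrAC.
rewrite -(ler_pM2r (powR_gt0 p fl)) => /le_trans key.
rewrite mulrA [V * _]mulrC; apply: key.
rewrite (powRM (y := l)) ?mulr_ge0 ?(ltW l0) ?(ltW pi0)//.
rewrite (powRM (x := C)) ?mulr_ge0 ?(ltW C_gt0) ?(ltW pi0)//.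
rewrite powRD; last by rewrite (gt_eqF l0) implybT.
move: (powR_ge0 C p) (powR_ge0 (4 * pi) p) (powR_ge0 l p) => X0' Y0 Z0.
move: (C `^ p) ((4 * pi) `^ p) (l `^ p) (r `^ lam) (l `^ lam) rll X0' Y0 Z0
  => X Y Z r' l' rl' X0' Y0 Z0.
have -> : X * M * r' * (Y * Z) = X * Y * Z * M * r' by ring.
have -> : X * Y * (Z * l') * M = X * Y * Z * M * l' by ring.
by rewrite ler_wpM2l// !mulr_ge0.
Qed.

End Testing.

Section Mass.
Context {R : realType}.
Notation mu := (@lebesgue_measure R).

Lemma wmass_itv_fin (w : R -> R) (a l : R) : 0 < l -> weight w ->
  exists2 V : R, 0 < V & wmass (positive_version w) `]a, (a + l)%R[ = V%:E.
Proof.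
move=> l0 [[mw _ lw] wpos].
set v := positive_version w.
have mv : measurable_fun setT v by exact: measurable_positive_version.
have v0 x : 0 < v x by exact: positive_version_gt0.
have mS (A : set R) : measurable_fun A v by exact: measurable_funS mv.
have Vpos : (0 < wmass v `]a, (a + l)%R[)%E.
  apply: integral_gt0 => //.
  by rewrite lebesgue_measure_adjacent// lte_fin.
have Vfin : (wmass v `]a, (a + l)%R[ < +oo)%E.
  apply: (@le_lt_trans _ _ (wmass v `[a, (a + l)%R])).
    apply: ge0_subset_integral => //.
    - by apply/measurable_EFinP; exact: mS.
    - by move=> x _; rewrite lee_fin ltW.
    - by apply: subset_itv; rewrite bnd_simp.
  rewrite -(@wmass_version _ (fun x => `|w x|) v)//.
  - apply: lw => //; exact: segment_compact.
  - exact: measurableT_comp.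
  - apply: lebesgue_aeS wpos => x wx.
    by rewrite /v /positive_version wx gtr0_norm.
exists (fine (wmass v `]a, (a + l)%R[)); first by rewrite fine_gt0// Vpos.
by rewrite fineK// ge0_fin_numE// ltW.
Qed.

(** Both applications test a function cut off to a measurable part E of the
    interval; as p > 0, its zero values outside E contribute to no integral. *)
Lemma testing_restrict (p lam K : R) (v : R -> R) (E : set R)
    (g : R -> R) (a c l M V s : R) :
  1 <= p -> testing_condition p lam v K ->
  0 < l -> c = a + l \/ c = a - l ->
  measurable E -> E `<=` `]a, (a + l)%R[ ->
  measurable_fun setT g -> (forall x, 0 <= g x) ->
  0 <= M ->
  (forall x r : R, 0 < r ->
    (\int[mu]_(y in B x r `&` E) (g y `^ p * v y)%:E <= (M * r `^ lam)%:E)%E) ->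
  wmass v `]c, (c + l)%R[ = V%:E ->
  (\int[mu]_(x in E) (g x)%:E = s%:E)%E ->
  V * s `^ p <= K * l `^ (p + lam) * M.
Proof.
move=> p1 vK l0 adj mE EI mg g0 M0 gM vJ gs.
have p0 : p != 0 by rewrite gt_eqF// (lt_le_trans _ p1).
pose f := g \_ E.
have fE x : E x -> f x = g x by move=> Ex; rewrite /f patchE mem_set.
have fnE x : ~ E x -> f x = 0.
  by move=> Ex; rewrite /f patchE memNset.
have mf : measurable_fun setT f.
  by apply/(measurable_restrictT g mE); exact: measurable_funS mg.
have f0 x : 0 <= f x.
  by have [/fE ->//|/fnE ->] := pselect (E x).
have If (A : set R) : measurable A ->
    (\int[mu]_(x in A) (f x)%:E = \int[mu]_(x in A `&` E) (g x)%:E)%E.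
  move=> mA; rewrite integral_mkcondr; apply: eq_integral => x _.
  by rewrite /f -[RHS]/(((EFin \o g) \_ E) x) restrict_EFin.
have IE : (\int[mu]_(x in `]a, (a + l)%R[) (f x)%:E = s%:E)%E.
  by rewrite If// setIidr.
have intf : mu.-integrable `]a, (a + l)%R[ (fun x => (f x)%:E).
  apply/integrableP; split.
    by apply/measurable_EFinP; exact: measurable_funS mf.
  under eq_integral do rewrite gee0_abs ?lee_fin//.
  by rewrite IE ltry.
have := vK _ _ _ _ _ _ l0 adj mf f0 _ intf M0 _ vJ.
rewrite /Rintegral IE/=; apply.
  by move=> x nI; apply: fnE => /EI.
move=> x r r0; apply: le_trans (gM x r r0).
rewrite integral_mkcondr le_eqVlt; apply/orP; left; apply/eqP.
apply: eq_integral => y _; rewrite patchE; case: ifPn => [/set_mem/fE ->//|].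
by move=> /negP yE; rewrite fnE ?powR0 ?mul0r// => /mem_set.
Qed.

End Mass.

(** * The case q > 1 *)

Section DualWeight.
Context {R : realType}.
Notation mu := (@lebesgue_measure R).

Definition dual_weight (q : R) (v : R -> R) (x : R) : R :=
  v x `^ (- (q - 1)^-1).

Variables (p lam K : R) (v : R -> R).
Hypotheses (p1 : 1 <= p) (lam0 : 0 <= lam) (lam1 : lam < 1) (K0 : 0 < K).
Hypotheses (mv : measurable_fun setT v) (v0 : forall x, 0 < v x).
Hypothesis vK : testing_condition p lam v K.

Local Notation q := (p + lam).
Local Notation sg := (dual_weight q v).

Lemma dual_weight_gt0 x : 0 < sg x.
Proof. exact: powR_gt0. Qed.

Lemma measurable_dual_weight : measurable_fun setT sg.
Proof. exact: measurable_fun_powR. Qed.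

Let Kq := K * 2 `^ lam.

Hypothesis q1 : 1 < q.

Let q10 : 0 < q - 1. Proof. by rewrite subr_gt0. Qed.

Lemma dual_weightK x : sg x `^ (q - 1) * v x = 1.
Proof.
rewrite /dual_weight -powRrM mulNr mulVf ?gt_eqF// powR_inv1 ?ltW//.
by rewrite mulVf// gt_eqF.
Qed.

(** The reason for the exponent of the dual weight: tested against v it
    reproduces a power of itself with exponent at most 1, which Hoelder turns
    into a Morrey bound. *)
Lemma dual_weight_test x : sg x `^ p * v x = sg x `^ (1 - lam).
Proof.
have pE : p = (1 - lam) + (q - 1) by ring.
rewrite [X in sg x `^ X]pE powRD;
  last by rewrite (gt_eqF (dual_weight_gt0 x)) implybT.
by rewrite -mulrA dual_weightK mulr1.
Qed.

(** Where v >= e the dual weight is bounded, hence its mass s is finite and the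
    factor s^(1-lam) coming from the Morrey bound can be cancelled. *)
Lemma dual_mass_trunc_le (a c l V e : R) :
  0 < l -> c = a + l \/ c = a - l -> 0 < V -> 0 < e ->
  wmass v `]c, (c + l)%R[ = V%:E ->
  (\int[mu]_(x in `]a, (a + l)%R[ `&` [set x | (e <= v x)%R]) (sg x)%:E <=
    ((Kq * l `^ q / V) `^ (q - 1)^-1)%:E)%E.
Proof.
move=> l0 adj V0 e0 vJ.
set E := _ `&` _.
have mE : measurable E.
  by apply: measurableI => //; exact: measurable_superlevel.
have EI : E `<=` `]a, (a + l)%R[ by move=> x [].
have aal : a < a + l by rewrite ltrDl.
have [m _ mE_] := mu_subset_fin aal mE EI.
have sgN x : E x -> sg x <= e `^ (- (q - 1)^-1).
  move=> [_ /= ev]; rewrite /dual_weight !powRN lef_pV2 ?posrE ?powR_gt0//.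
  by apply: ge0_ler_powR ev; rewrite ?nnegrE ?invr_ge0 ltW.
have msg := measurable_dual_weight.
have mS (A : set R) : measurable_fun A sg by exact: measurable_funS msg.
have s_fin : (\int[mu]_(x in E) (sg x)%:E < +oo)%E.
  apply: (@le_lt_trans _ _ (\int[mu]_(x in E) (e `^ (- (q - 1)^-1))%:E)%E).
    apply: ge0_le_integral => //.
    - by move=> x _; rewrite lee_fin ltW// dual_weight_gt0.
    - by apply/measurable_EFinP; exact: mS.
  by rewrite integral_cst// [X in (_ * X)%E]mE_ -EFinM ltry.
have s_ge0 : (0 <= \int[mu]_(x in E) (sg x)%:E)%E.
  by apply: integral_ge0 => x _; rewrite lee_fin ltW// dual_weight_gt0.
have [s sE] : exists s : R, (\int[mu]_(x in E) (sg x)%:E = s%:E)%E.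
  by exists (fine (\int[mu]_(x in E) (sg x)%:E)); rewrite fineK// ge0_fin_numE.
rewrite sE lee_fin.
have D0 : 0 <= (Kq * l `^ q / V) by rewrite divr_ge0 ?mulr_ge0 ?powR_ge0 ?ltW.
have : 0 <= s by rewrite -lee_fin -sE.
rewrite le_eqVlt => /predU1P[<-|s0]; first exact: powR_ge0.
have test (x r : R) : 0 < r ->
    (\int[mu]_(y in B x r `&` E) (sg y `^ p * v y)%:E <=
      (s `^ (1 - lam) * 2 `^ lam * r `^ lam)%:E)%E.
  move=> r0.
  have r20 : 0 < 2 * r by rewrite mulr_gt0.
  have mBE : measurable (B x r `&` E).
    by apply: measurableI => //; exact: measurable_itv.
  have -> : s `^ (1 - lam) * 2 `^ lam * r `^ lam =
            s `^ (1 - lam) * (2 * r) `^ (1 - (1 - lam)).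
    by rewrite subKr powRM ?ltW// mulrA.
  have -> : (\int[mu]_(y in B x r `&` E) (sg y `^ p * v y)%:E =
    \int[mu]_(y in B x r `&` E)
      (sg y `^ (1 - lam) * 1 `^ (1 - (1 - lam)))%:E)%E.
    by apply: eq_integral => y _; rewrite dual_weight_test powR1 mulr1.
  apply: (@hoelder_bound _ _ sg (cst 1)) => //.
  - by move=> y _; rewrite ltW// dual_weight_gt0.
  - by rewrite subr_gt0.
  - by rewrite gerBl.
  - rewrite -sE; apply: ge0_subset_integral => //.
    + by apply/measurable_EFinP; exact: mS.
    + by move=> y _; rewrite lee_fin ltW// dual_weight_gt0.
  - rewrite (@integral_cst _ _ _ mu _ mBE 1%E) mul1e.
    have <- : mu (B x r) = (2 * r)%:E.
      rewrite /B lebesgue_measure_itv/= lte_fin ltrD2l gtrN// -EFinB.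
      by congr _%:E; ring.
    by apply: le_measure; rewrite ?inE//; exact: measurable_itv.
have sge x : 0 <= sg x by rewrite ltW// dual_weight_gt0.
have := testing_restrict p1 vK l0 adj mE EI msg sge _ test vJ sE.
move=> /(_ (mulr_ge0 (powR_ge0 _ _) (powR_ge0 _ _))).
have -> : s `^ p = s `^ (q - 1) * s `^ (1 - lam).
  rewrite -powRD; last by rewrite (gt_eqF s0) implybT.
  by congr (_ `^ _); ring.
have s1 : 0 < s `^ (1 - lam) by exact: powR_gt0.
have -> : K * l `^ q * (s `^ (1 - lam) * 2 `^ lam) =
    Kq * l `^ q * s `^ (1 - lam).
  by rewrite /Kq; ring.
rewrite mulrA ler_pM2r// mulrC -ler_pdivlMr// => sV.
have -> : s = (s `^ (q - 1)) `^ (q - 1)^-1.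
  by rewrite -powRrM mulfV ?gt_eqF// powRr1// ltW.
by apply: ge0_ler_powR sV; rewrite ?nnegrE ?invr_ge0 ?powR_ge0// ltW.
Qed.

Lemma dual_mass_le (a c l V : R) :
  0 < l -> c = a + l \/ c = a - l -> 0 < V ->
  wmass v `]c, (c + l)%R[ = V%:E ->
  (wmass sg `]a, (a + l)%R[ <= ((Kq * l `^ q / V) `^ (q - 1)^-1)%:E)%E.
Proof.
move=> l0 adj V0 vJ.
pose F n := `]a, (a + l)%R[ `&` [set x | ((n.+1%:R)^-1 <= v x)%R].
have mF n : measurable (F n).
  by apply: measurableI => //; exact: measurable_superlevel.
have ndF : nondecreasing_seq F.
  move=> m n mn; apply/subsetPset => x [Ix /= vx]; split => //=.
  by apply: le_trans vx; rewrite lef_pV2 ?posrE// ler_nat.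
have FI : \bigcup_n F n = `]a, (a + l)%R[%classic.
  apply/seteqP; split => [x [n _ []]//|x Ix].
  have [n _ /(_ n (leqnn n)) nx] := near_infty_natSinv_lt (PosNum (v0 x)).
  by exists n => //; split => //=; exact: ltW.
have msg := measurable_dual_weight.
have : (\int[mu]_(x in F n) (sg x)%:E @[n --> \oo] -->
    wmass sg `]a, (a + l)%R[)%E.
  rewrite /wmass -FI; apply: ge0_nondecreasing_set_cvg_integral => //.
    by move=> n; apply/measurable_EFinP; exact: measurable_funS msg.
  by move=> n x _; rewrite lee_fin ltW// dual_weight_gt0.
move=> cv; rewrite -(cvg_lim _ cv)//; apply: lime_le; first exact: cvgP cv.
by near=> n; apply: (dual_mass_trunc_le l0 adj V0 _ vJ); rewrite invr_gt0.
Unshelve. all: by end_near. Qed.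

(** Since v sigma^(q-1) = 1, Hoelder gives l^q <= W sigma(I)^(q-1) for
    I = (a, a + l), and [dual_mass_le] bounds the right-hand side by
    Kq l^q W / V. *)
Lemma mass_adjacent_le (a c l V W : R) :
  0 < l -> c = a + l \/ c = a - l -> 0 < V -> 0 < W ->
  wmass v `]c, (c + l)%R[ = V%:E -> wmass v `]a, (a + l)%R[ = W%:E ->
  V <= Kq * W.
Proof.
move=> l0 adj V0 W0 vJ vI.
have Kq0 : 0 < Kq by rewrite mulr_gt0// powR_gt0.
set D := (Kq * l `^ q / V) `^ (q - 1)^-1.
have X0 : 0 < Kq * l `^ q / V by rewrite divr_gt0// mulr_gt0// powR_gt0.
have D0 : 0 < D by exact: powR_gt0.
have q0 : 0 < q by exact: lt_trans q1.
have sI := dual_mass_le l0 adj V0 vJ.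
have mS (A : set R) : measurable_fun A v by exact: measurable_funS mv.
have mS' (A : set R) : measurable_fun A sg.
  exact: measurable_funS measurable_dual_weight.
have := @hoelder_bound _ `]a, (a + l)%R[ v sg q^-1 W D
  (measurable_itv _) (mS _) (mS' _).
have th : 1 - q^-1 = (q - 1) * q^-1 by rewrite mulrBl mulfV ?gt_eqF// mul1r.
have -> : (\int[mu]_(x in `]a, (a + l)%R[)
    (v x `^ q^-1 * sg x `^ (1 - q^-1))%:E = l%:E)%E.
  rewrite -[RHS]mul1e -(@lebesgue_measure_adjacent R a)//.
  rewrite -integral_cst//; apply: eq_integral => x _ /=.
  rewrite th powRrM -powRM ?powR_ge0 ?ltW//.
  by rewrite mulrC dual_weightK powR1.
have -> : W `^ q^-1 * D `^ (1 - q^-1) = (W * (Kq * l `^ q / V)) `^ q^-1.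
  have DX : D `^ (q - 1) = Kq * l `^ q / V.
    by rewrite /D -powRrM mulVf ?gt_eqF// powRr1// ltW.
  rewrite th powRrM DX.
  by rewrite [RHS]powRM ?(ltW W0) ?(ltW X0).
rewrite lee_fin.
move=> /(_ (fun x _ => ltW (v0 x)) (fun x _ => ltW (dual_weight_gt0 x))).
have iq0 : 0 < q^-1 by rewrite invr_gt0.
have iq1 : q^-1 <= 1 by rewrite invf_le1// ltW.
have vIW : (wmass v `]a, (a + l)%R[ <= W%:E)%E by rewrite vI.
move=> /(_ iq0 iq1 W0 D0 vIW sI) lW.
have : l `^ q <= ((W * (Kq * l `^ q / V)) `^ q^-1) `^ q.
  by apply: ge0_ler_powR lW; rewrite ?nnegrE ?powR_ge0 ?ltW.
have WX : 0 <= W * (Kq * l `^ q / V) by rewrite mulr_ge0 ?ltW.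
rewrite -powRrM mulVf ?gt_eqF// powRr1//.
have -> : W * (Kq * l `^ q / V) = (Kq * W / V) * l `^ q by ring.
have lq : 0 < l `^ q by exact: powR_gt0.
by rewrite -[X in X <= _]mul1r ler_pM2r// ler_pdivlMr// mul1r.
Qed.

End DualWeight.

Section Muckenhoupt.
Context {R : realType}.
Notation mu := (@lebesgue_measure R).

(** The dual mass of I = (a, b) is controlled by the mass V of the interval J to
    its right; replacing V by the mass W of I costs a second factor Kq. *)
Lemma Aq_of_testing (w : R -> R) (p lam K : R) :
  1 <= p -> 0 <= lam -> lam < 1 -> 1 < p + lam -> weight w -> 0 < K ->
  testing_condition p lam (positive_version w) K -> Aq_class (p + lam) w.
Proof.
move=> p1 lam0 lam1 q1 hw K0 vK; have [[mw _ _] wpos] := hw.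
set v := positive_version w in vK.
have mv : measurable_fun setT v by exact: measurable_positive_version.
have v0 x : 0 < v x by exact: positive_version_gt0.
have wv : {ae mu, forall x, w x = v x} := positive_version_ae wpos.
set q := p + lam in q1 *.
have q10 : 0 < q - 1 by rewrite subr_gt0.
pose Kq := K * 2 `^ lam.
have Kq0 : 0 < Kq by rewrite mulr_gt0// powR_gt0.
apply: (@le_lt_trans _ _ (Kq * Kq)%:E); last exact: ltry.
apply/ub_ereal_sup => _ [a [b [ab ->]]].
pose l : R := b - a; have l0 : 0 < l by rewrite subr_gt0.
have bE : b = a + l by rewrite addrC subrK.
have [W W0 vI] := wmass_itv_fin a l0 hw.
have [V V0 vJ] := wmass_itv_fin b l0 hw.
rewrite -/v in vI vJ.
have adjba : a = b + l \/ a = b - l by right; rewrite bE addrK.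
have WV := mass_adjacent_le p1 lam0 lam1 K0 mv v0 vK q1 l0 adjba W0 V0 vI vJ.
have sI := dual_mass_le p1 lam0 lam1 K0 mv v0 vK q1 l0 (or_introl bE) V0 vJ.
rewrite -/Kq -/q in WV sI.
set D := (Kq * l `^ q / V) `^ (q - 1)^-1 in sI.
have X0 : 0 < Kq * l `^ q / V by rewrite divr_gt0// mulr_gt0// powR_gt0.
have D0 : 0 < D by exact: powR_gt0.
have expE : 1 - conj_exponent q = - (q - 1)^-1.
  by rewrite /conj_exponent; field; rewrite gt_eqF.
have -> : wmass (fun x => w x `^ (1 - conj_exponent q)) `]a, b[ =
    wmass (dual_weight q v) `]a, (a + l)%R[.
  rewrite expE -bE; apply: wmass_version; last exact: measurable_itv.
  - exact: measurable_fun_powR.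
  - exact: measurable_fun_powR.
  - by apply: (lebesgue_aeS _ wv) => x ->.
rewrite (wmass_version mw mv wv); last exact: measurable_itv.
rewrite {2}bE vI -/l.
have S0 : (0 <= wmass (dual_weight q v) `]a, (a + l)%R[)%E.
  by apply: integral_ge0 => x _; rewrite lee_fin powR_ge0.
have li0 : 0 < l^-1 by rewrite invr_gt0.
apply: (@le_trans _ _ ((l^-1%:E * W%:E) * ((l^-1 * D) `^ (q - 1))%:E)%E).
  apply: lee_wpmul2l; first by rewrite -EFinM lee_fin mulr_ge0// ltW.
  rewrite -poweR_EFin; apply: gt0_ler_poweR.
  - exact: ltW.
  - by rewrite in_itv/= leey andbT mule_ge0// lee_fin ltW.
  - by rewrite in_itv/= leey andbT lee_fin mulr_ge0// ltW.
  - by rewrite EFinM; apply: lee_wpmul2l => //; rewrite lee_fin ltW.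
rewrite -!EFinM lee_fin powRM ?(ltW li0) ?(ltW D0)//.
have -> : D `^ (q - 1) = Kq * l `^ q / V.
  by rewrite /D -powRrM mulVf ?gt_eqF// powRr1// ltW.
have -> : l^-1 `^ (q - 1) = l / l `^ q.
  rewrite -powR_inv1 ?(ltW l0)// -powRrM mulN1r opprB.
  by rewrite powRB ?powRr1 ?(ltW l0)// (gt_eqF l0) implybT.
have lq : 0 < l `^ q by exact: powR_gt0.
have -> : l^-1 * W * (l / l `^ q * (Kq * l `^ q / V)) = Kq * (W / V).
  by field; rewrite !gt_eqF.
by rewrite ler_pM2l// ler_pdivrMr.
Qed.

(** * The case q = 1 *)

(** For p = 1 and lam = 0 the Morrey norm is the weighted L^1 norm, so that the
    indicator of E can be tested with M = v(E). *)
Lemma testing_submass (K : R) (v : R -> R) :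
  measurable_fun setT v -> (forall x, 0 < v x) -> testing_condition 1 0 v K ->
  forall (E : set R) (a c l V m s : R), 0 < l -> c = a + l \/ c = a - l ->
  measurable E -> E `<=` `]a, (a + l)%R[ ->
  wmass v `]c, (c + l)%R[ = V%:E -> mu E = m%:E -> wmass v E = s%:E ->
  V * m <= K * l * s.
Proof.
move=> mv v0 vK E a c l V m s l0 adj mE EI vJ muE vE.
have s0 : 0 <= s.
  by rewrite -lee_fin -vE; apply: integral_ge0 => x _; rewrite lee_fin ltW.
have m0 : 0 <= m by rewrite -lee_fin -muE measure_ge0.
have IE : (\int[mu]_(x in E) (cst 1 x)%:E = m%:E)%E.
  by rewrite (@integral_cst _ _ _ mu _ mE 1%E) mul1e.
have mS (A : set R) : measurable_fun A v by exact: measurable_funS mv.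
have m1 : measurable_fun setT (cst 1 : R -> R) by exact: measurable_cst.
have := testing_restrict (lexx 1) vK l0 adj mE EI m1 (fun=> ler01)
  s0 _ vJ IE.
rewrite addr0 !powRr1// ?(ltW l0)//; apply.
move=> x r r0; rewrite powRr0 mulr1 -vE.
rewrite (_ : (\int[mu]_(y in _) _ = wmass v (B x r `&` E))%E); last first.
  by apply: eq_integral => y _; rewrite powR1 mul1r.
apply: ge0_subset_integral => //.
- by apply: measurableI => //; exact: measurable_itv.
- by apply/measurable_EFinP; exact: mS.
- by move=> y _; rewrite lee_fin ltW.
Qed.

(** The exceptional set E, where K^2 v is smaller than the mean of v over I,
    would violate W |E| <= K^2 l v(E) if it had positive measure. *)
Lemma A1_of_testing (w : R -> R) (K : R) : weight w -> 0 < K ->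
  testing_condition 1 0 (positive_version w) K -> A1_class w.
Proof.
move=> hw K0 vK; have [[mw _ _] wpos] := hw.
set v := positive_version w in vK.
have mv : measurable_fun setT v by exact: measurable_positive_version.
have v0 x : 0 < v x by exact: positive_version_gt0.
have wv : {ae mu, forall x, w x = v x} := positive_version_ae wpos.
have mS (A : set R) : measurable_fun A v by exact: measurable_funS mv.
exists (K * K) => a b ab.
pose l : R := b - a; have l0 : 0 < l by rewrite subr_gt0.
have bE : b = a + l by rewrite addrC subrK.
have [W W0 vI] := wmass_itv_fin a l0 hw.
have [V V0 vJ] := wmass_itv_fin b l0 hw.
rewrite -/v in vI vJ.
have WV : W <= K * V.
  have := testing_submass mv v0 vK l0 _ (measurable_itv _) (@subset_refl _ _) vI
    (lebesgue_measure_adjacent b l0) vJ.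
  move=> /(_ (or_intror _)); rewrite mulrAC ler_pM2r//; apply.
  by rewrite bE addrK.
pose E := `]a, (a + l)%R[ `&` [set x | (K * K * v x < W / l)%R].
have mE : measurable E.
  apply: measurableI => //.
  rewrite (_ : [set x | _] = ~` [set x | (W / l / (K * K) <= v x)%R]).
    by apply: measurableC; exact: (measurable_superlevel _ mv).
  apply/seteqP; split => x /=; rewrite ler_pdivrMr ?mulr_gt0// [v x * _]mulrC.
    by rewrite ltNge => /negP.
  by move/negP; rewrite -ltNge.
have EI : E `<=` `]a, (a + l)%R[ by move=> x [].
have aal : a < a + l by rewrite ltrDl.
have [m m0 muE] := mu_subset_fin aal mE EI.
have sW : (wmass v E <= W%:E)%E.
  rewrite -vI; apply: ge0_subset_integral => //.
  - by apply/measurable_EFinP; exact: mS.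
  - by move=> y _; rewrite lee_fin ltW.
have s_ge0 : (0 <= wmass v E)%E.
  by apply: integral_ge0 => x _; rewrite lee_fin ltW.
have [s sE] : exists s : R, wmass v E = s%:E.
  exists (fine (wmass v E)); rewrite fineK// ge0_fin_numE//.
  by rewrite (le_lt_trans sW) ?ltry.
have Vm : V * m <= K * l * s.
  by apply: (testing_submass mv v0 vK l0 _ mE EI vJ muE sE); left.
have mE0 : m = 0.
  apply/eqP; rewrite eq_le m0 andbT leNgt; apply/negP => m_gt0.
  have u0 x : E x -> 0 < W / l - K * K * v x by move=> [_ /=]; rewrite subr_gt0.
  have mu_ : measurable_fun E (fun x => W / l - K * K * v x).
    by apply: measurable_funB => //; apply: measurable_funM.
  have := integral_gt0 mE mu_ u0; rewrite muE lte_fin => /(_ m_gt0).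
  have split_ : (\int[mu]_(x in E) (W / l - K * K * v x)%:E + (K * K * s)%:E
     = (W / l * m)%:E)%E.
    rewrite EFinM -sE /wmass -ge0_integralZl_EFin//; last 3 first.
    - by move=> y _; rewrite lee_fin ltW.
    - by apply/measurable_EFinP; exact: mS.
    - by rewrite mulr_ge0// ltW.
    rewrite -ge0_integralD//; last 4 first.
    - by move=> x Ex; rewrite lee_fin ltW// u0.
    - exact/measurable_EFinP.
    - by move=> x Ex; rewrite -EFinM lee_fin ltW// !mulr_gt0.
    - by apply: measurable_funeM; apply/measurable_EFinP; exact: mS.
    rewrite [(W / l * m)%:E]EFinM -muE -integral_cst//.
    by apply: eq_integral => x _ /=; rewrite -EFinM -EFinD subrK.
  have -> : (\int[mu]_(x in E) (W / l - K * K * v x)%:E =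
      (W / l * m - K * K * s)%:E)%E.
    by rewrite EFinB -split_ addeK.
  rewrite lte_fin subr_gt0; apply/negP; rewrite -leNgt.
  rewrite mulrAC ler_pdivrMr//.
  have := ler_wpM2l (ltW K0) Vm; have := ler_wpM2r m0 WV; lra.
have nE : {ae mu, forall x, ~ E x}.
  exists E; split => //; first by rewrite muE mE0.
  by move=> x /= /contrapT.
apply: (lebesgue_aeS2 _ wv nE) => x wvx nEx Ix.
rewrite (wmass_version mw mv wv); last exact: measurable_itv.
rewrite {2}bE vI -EFinM lee_fin wvx leNgt; apply/negP => lt.
by apply: nEx; split; [rewrite -bE|rewrite /= [W / l]mulrC].
Qed.

End Muckenhoupt.

Theorem proposition5p4 (R : realType) (p lam : R) (w : R -> R)
  (hp : 1 <= p) (hlam0 : 0 <= lam) (hlam1 : lam < 1)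
  (hw : weight w) (hH : hilbert_bounded p lam w) :
  muckenhoupt (p + lam) w.
Proof.
have [[mw _ _] wpos] := hw.
have [K K0 vK] := hilbert_testing hp hlam0 hH mw
  (measurable_positive_version mw) (positive_version_ae wpos)
  (positive_version_gt0 w).
have q1 : 1 <= p + lam by rewrite (le_trans hp)// lerDl.
have [pl1|q_neq1] := eqVneq (p + lam) 1.
  have lamE : lam = 0 by lra.
  have pE : p = 1 by lra.
  by left; split => //; apply: (A1_of_testing hw K0); rewrite -pE -lamE.
have {}q1 : 1 < p + lam by rewrite lt_def q_neq1.
by right; split => //; exact: (Aq_of_testing hp hlam0 hlam1 q1 hw K0 vK).
Qed.
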